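(* Let $X$ be a Banach space and let $T\in L(X)$. Then the following statements are equivalent: (i) $T$ is EP; (ii) there exist two Banach spaces $X_1$ and $X_2$, an isomorphism $T_1\in L(X_1)$, and a bounded linear isomorphism $J\colon X_1\oplus_1X_2\to X$ such that $T=J(T_1\oplus 0)J^{-1}$ and $J(I_1\oplus 0)J^{-1}\in L(X)$ is a hermitian idempotent, where $I_1$ is the identity map of $X_1$.
   Context: Banach spaces are complex; $L(X)$ is the algebra of bounded linear maps on $X$. $X_1\oplus_1X_2$ is the direct sum with norm $\|x_1\oplus x_2\|=\|x_1\|+\|x_2\|$, and for $S\in L(X_1)$, $S\oplus 0\in L(X_1\oplus_1 X_2)$ is the map $x_1\oplus x_2\mapsto Sx_1\oplus 0$. An isomorphism is a bijective bounded linear map (not necessarily isometric). An operator $S\in L(X)$ is hermitian if $\|\exp(itS)\|=1$ for all $t\in\mathbb{R}$. The Moore-Penrose inverse of $T\in L(X)$, if it exists, is the (unique) $S\in L(X)$ with $T=TST$, $S=STS$ and $TS$, $ST$ hermitian; it is denoted $T^{\dag}$. $T$ is EP if $T^{\dag}$ exists and $TT^{\dag}=T^{\dag}T$. *)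

(* Defs.v *)
From HB Require Import structures.
From mathcomp Require Import all_boot all_order all_algebra.
From mathcomp Require Import complex.
From mathcomp Require Import all_classical all_reals.
From mathcomp Require Import topology normedtype sequences.

Set Implicit Arguments.
Unset Strict Implicit.
Unset Printing Implicit Defensive.

Import Order.TTheory GRing.Theory Num.Theory.
Import numFieldNormedType.Exports.

Local Open Scope classical_set_scope.
Local Open Scope ring_scope.
Local Open Scope complex_scope.

(* Complex Banach spaces are objects of type completeNormedModType R[i]. Norms
   then take their values in R[i], namely among the nonnegative reals. *)

Section NormRe.
Context (R : realType) (X : normedModType R[i]).

Lemma normE_Re (x : X) : `|x| = (complex.Re `|x|)%:C.
Proof.
have : `|x| \is Num.real by exact: normr_real.
by case/complex_realP => k ->.
Qed.

Lemma lec_norm (x : X) (k : R) : (`|x| <= k%:C) = (complex.Re `|x| <= k).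
Proof. by rewrite normE_Re lecR. Qed.

Lemma Re_norm_ge0 (x : X) : 0 <= complex.Re `|x|.
Proof. by rewrite -lecR -normE_Re normr_ge0. Qed.

Lemma normcE_Re (a : R[i]) : `|a| = (complex.Re `|a|)%:C.
Proof.
have : `|a| \is Num.real by exact: normr_real.
by case/complex_realP => k ->.
Qed.

End NormRe.

Definition bounded_linear (R : realType) (X Y : normedModType R[i])
    (f : X -> Y) : Prop :=
  linear f /\ exists M : R, forall x, `|f x| <= M%:C * `|x|.

Definition bounded_linear_pred (R : realType) (X Y : normedModType R[i]) :
    {pred X -> Y} :=
  mem [set f : X -> Y | bounded_linear f].

Section BoundedLinear.
Context (R : realType) (X Y : normedModType R[i]).

Lemma bounded_linear_submod : submod_closed (@bounded_linear_pred R X Y).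
Proof.
split.
  rewrite inE; split.
    by move=> a x y; rewrite [RHS]addr0 scaler0.
  by exists 0 => x; rewrite mul0r normr0.
move=> a f g; rewrite !inE => -[lf [M Mf]] [lg [N Ng]]; split.
  move=> b x y.
  rewrite -[LHS]/(a *: f (b *: x + y) + g (b *: x + y)).
  rewrite -[RHS]/(b *: (a *: f x + g x) + (a *: f y + g y)).
  by rewrite lf lg !scalerDr !scalerA (mulrC a b) addrACA.
exists (complex.Re `|a| * M + N) => x.
rewrite -[X in `|X|]/(a *: f x + g x).
rewrite (le_trans (ler_normD _ _))// rmorphD/= rmorphM/= mulrDl lerD//.
by rewrite normrZ -mulrA -normcE_Re ler_wpM2l.
Qed.

HB.instance Definition _ :=
  GRing.isSubmodClosed.Build R[i] (X -> Y) (@bounded_linear_pred R X Y)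
    (GRing.submod_closed_semi bounded_linear_submod).

(* The space L(X, Y) of bounded linear maps; L(X) is bop X X. *)
Record bop := Bop { bop_fun :> X -> Y ; _ : bop_fun \in @bounded_linear_pred R X Y }.

HB.instance Definition _ := [isSub for bop_fun].
HB.instance Definition _ := [Choice of bop by <:].
HB.instance Definition _ := [SubChoice_isSubLmodule of bop by <:].

Lemma bop_bounded_linear (f : bop) : bounded_linear f.
Proof. by case: f => f /=; rewrite inE. Qed.

Definition mkbop (f : X -> Y) (hf : bounded_linear f) : bop :=
  Bop (mem_set hf).

Lemma bopP (f g : bop) : f =1 g -> f = g.
Proof. by move=> fg; apply/val_inj/funext. Qed.

Lemma bop_linear (f : bop) : linear f.
Proof. by case: (bop_bounded_linear f). Qed.

HB.instance Definition _ (f : bop) :=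
  GRing.isLinear.Build R[i] X Y *:%R f (bop_linear f).

Definition opnorm (f : bop) : R :=
  sup [set complex.Re `|f x| | x in [set x : X | `|x| <= 1]].

Lemma has_sup_opnorm (f : bop) :
  has_sup [set complex.Re `|f x| | x in [set x : X | `|x| <= 1]].
Proof.
split; first by exists (complex.Re `|f 0|), 0 => //=; rewrite normr0.
have [_ [M Mf]] := bop_bounded_linear f.
exists `|M| => _ [x /= x1 <-]; rewrite -lec_norm (le_trans (Mf x))//.
rewrite (@le_trans _ _ (`|M|%:C * `|x|))//.
  by rewrite ler_wpM2r// lecR ler_norm.
by rewrite -[leRHS]mulr1 ler_wpM2l// lecR.
Qed.

Lemma opnorm_ub (f : bop) x : `|x| <= 1 -> complex.Re `|f x| <= opnorm f.
Proof. by move=> x1; apply: (sup_upper_bound (has_sup_opnorm f)); exists x. Qed.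

Lemma opnorm_le (f : bop) (M : R) :
  (forall x, `|x| <= 1 -> complex.Re `|f x| <= M) -> opnorm f <= M.
Proof.
move=> H; apply: ge_sup; first by case: (has_sup_opnorm f).
by move=> _ [x /= x1 <-]; exact: H.
Qed.

Lemma opnorm_ge0 (f : bop) : 0 <= opnorm f.
Proof.
apply: le_trans (opnorm_ub f (x := 0) _); last by rewrite normr0.
exact: Re_norm_ge0.
Qed.

Lemma le_opnorm (f : bop) x : `|f x| <= (opnorm f)%:C * `|x|.
Proof.
have [->|x0] := eqVneq x 0; first by rewrite linear0 !normr0 mulr0.
have nx0 : 0 < `|x| by rewrite normr_gt0.
rewrite -ler_pdivrMr// mulrC.
have -> : `|x|^-1 * `|f x| = `|f (`|x|^-1 *: x)|.
  by rewrite linearZ normrZ ger0_norm// invr_ge0.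
rewrite lec_norm opnorm_ub// normrZ ger0_norm ?invr_ge0//.
by rewrite mulVf ?gt_eqF.
Qed.

Lemma opnormD (f g : bop) :
  (opnorm (f + g))%:C <= (opnorm f)%:C + (opnorm g)%:C.
Proof.
rewrite -rmorphD lecR; apply: opnorm_le => x x1; rewrite -lec_norm.
rewrite -[X in `|X|]/(f x + g x) (le_trans (ler_normD _ _))// rmorphD/=.
by rewrite lerD// lec_norm opnorm_ub.
Qed.

Lemma opnormZ_le (a : R[i]) (f : bop) :
  (opnorm (a *: f))%:C <= `|a| * (opnorm f)%:C.
Proof.
rewrite normcE_Re -rmorphM lecR; apply: opnorm_le => x x1; rewrite -lec_norm.
rewrite -[X in `|X|]/(a *: f x) normrZ rmorphM/= -normcE_Re ler_wpM2l//.
by rewrite lec_norm opnorm_ub.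
Qed.

Lemma opnormZ (a : R[i]) (f : bop) :
  (opnorm (a *: f))%:C = `|a| * (opnorm f)%:C.
Proof.
apply/eqP; rewrite eq_le opnormZ_le/=.
have [->|a0] := eqVneq a 0; first by rewrite normr0 mul0r lecR opnorm_ge0.
rewrite -ler_pdivlMl ?normr_gt0// -normfV.
by rewrite -{1}[f](scalerK a0) opnormZ_le.
Qed.

Lemma opnorm_eq0 (f : bop) : (opnorm f)%:C = 0 :> R[i] -> f = 0.
Proof.
move=> f0; apply: bopP => x; apply/eqP; rewrite -normr_le0.
by rewrite (le_trans (le_opnorm f x))// f0 mul0r.
Qed.

HB.instance Definition _ :=
  Lmodule_isNormed.Build R[i] bop opnormD opnormZ opnorm_eq0.

End BoundedLinear.

Arguments bop {R} X Y.

Section Algebra.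
Context (R : realType).

Lemma bounded_linear_id (X : normedModType R[i]) : bounded_linear (@id X).
Proof. by split => //; exists 1 => x; rewrite mul1r. Qed.

Lemma bounded_linear_comp (X Y Z : normedModType R[i])
    (f : bop Y Z) (g : bop X Y) : bounded_linear (f \o g).
Proof.
split; first by move=> a x y /=; rewrite !linearP.
exists (opnorm f * opnorm g) => x /=; rewrite (le_trans (le_opnorm f _))//.
by rewrite rmorphM/= -mulrA ler_wpM2l ?lecR ?opnorm_ge0// le_opnorm.
Qed.

Context (X : normedModType R[i]).

Definition bop_one : bop X X := mkbop (@bounded_linear_id X).
Definition bop_mul (f g : bop X X) : bop X X := mkbop (bounded_linear_comp f g).

Lemma bop_mulA : associative bop_mul.
Proof. by move=> f g h; exact: bopP. Qed.

Lemma bop_mul1r : left_id bop_one bop_mul.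
Proof. by move=> f; exact: bopP. Qed.

Lemma bop_mulr1 : right_id bop_one bop_mul.
Proof. by move=> f; exact: bopP. Qed.

Lemma bop_mulDl : left_distributive bop_mul +%R.
Proof. by move=> f g h; exact: bopP. Qed.

Lemma bop_mulDr : right_distributive bop_mul +%R.
Proof. by move=> f g h; apply: bopP => x; exact: linearD. Qed.

HB.instance Definition _ := GRing.Zmodule_isPzRing.Build (bop X X)
  bop_mulA bop_mul1r bop_mulr1 bop_mulDl bop_mulDr.

(* The limit of the exponential series in the operator norm. *)
Definition bop_exp (A : bop X X) : bop X X :=
  limn (series (fun n => (n`!%:R : R[i])^-1 *: A ^+ n)).

(* On the zero space every operator has norm 0, so none is hermitian there. *)
Definition hermitian_op (S : bop X X) : Prop :=
  forall t : R, `|bop_exp (('i * t%:C) *: S)| = 1.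

Definition is_moore_penrose_inverse (T S : bop X X) : Prop :=
  [/\ T = T * S * T, S = S * T * S, hermitian_op (T * S) & hermitian_op (S * T)].

(* The Moore-Penrose inverse S is unique when it exists. *)
Definition EP (T : bop X X) : Prop :=
  exists S, is_moore_penrose_inverse T S /\ T * S = S * T.

End Algebra.

(* The product type carries the max norm in the library, hence this alias. *)
Definition l1sum (R : realType) (X1 X2 : normedModType R[i]) : Type :=
  (X1 * X2)%type.

Section L1Sum.
Context (R : realType) (X1 X2 : normedModType R[i]).

HB.instance Definition _ := GRing.Lmodule.copy (l1sum X1 X2) (X1 * X2)%type.

Definition l1norm (x : l1sum X1 X2) : R[i] := `|x.1| + `|x.2|.

Lemma l1normD x y : l1norm (x + y) <= l1norm x + l1norm y.
Proof. by rewrite /l1norm addrACA lerD// ler_normD. Qed.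

Lemma l1normZ a x : l1norm (a *: x) = `|a| * l1norm x.
Proof. by rewrite /l1norm mulrDr !normrZ. Qed.

Lemma l1norm_eq0 x : l1norm x = 0 -> x = 0.
Proof.
move=> /eqP; rewrite paddr_eq0// !normr_eq0 => /andP[/eqP x1 /eqP x2].
by rewrite [x]surjective_pairing x1 x2.
Qed.

HB.instance Definition _ :=
  Lmodule_isNormed.Build R[i] (l1sum X1 X2) l1normD l1normZ l1norm_eq0.

Lemma bounded_linear_oplus0 (S : bop X1 X1) :
  bounded_linear (fun x : l1sum X1 X2 => (S x.1, 0) : l1sum X1 X2).
Proof.
split.
  move=> a x y; apply: injective_projections; first exact: linearP.
  by rewrite -[RHS]/(a *: (0 : X2) + 0) scaler0 addr0.
exists (opnorm S) => x; rewrite -[leLHS]/(`|S x.1| + `|0|) normr0 addr0.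
rewrite (le_trans (le_opnorm S _))// ler_wpM2l ?lecR ?opnorm_ge0//.
by rewrite -[leRHS]/(`|x.1| + `|x.2|) lerDl.
Qed.

Definition oplus0 (S : bop X1 X1) : bop (l1sum X1 X2) (l1sum X1 X2) :=
  mkbop (bounded_linear_oplus0 S).

End L1Sum.

Arguments oplus0 {R X1} X2 S.

Section L1SumComplete.
Context (R : realType) (X1 X2 : completeNormedModType R[i]).

Lemma l1sum_cauchy_proj (Z : completeNormedModType R[i])
    (p : l1sum X1 X2 -> Z) (F : set_system (l1sum X1 X2)) :
  (forall x y, `|p x - p y| <= `|x - y|) ->
  ProperFilter F -> cauchy F -> cvg (p @ F).
Proof.
move=> pP FF /cauchyP Fc; apply: cauchy_cvg; apply: cauchy_exP => e e0.
have [x Fx] := Fc e e0; exists (p x).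
change (F (p @^-1` ball (p x) e)); apply: filterS Fx => y.
by rewrite /preimage/= -!ball_normE/=; exact: le_lt_trans.
Qed.

Lemma l1sum_complete (F : set_system (l1sum X1 X2)) :
  ProperFilter F -> cauchy F -> cvg F.
Proof.
move=> FF Fc.
have /cvg_ex[a1 /cvgrPdist_lt Fa1] : cvg ((fun x : l1sum X1 X2 => x.1 : X1) @ F).
  by apply: l1sum_cauchy_proj => // x y; rewrite -[leRHS]/(`|_| + `|_|) lerDl.
have /cvg_ex[a2 /cvgrPdist_lt Fa2] : cvg ((fun x : l1sum X1 X2 => x.2 : X2) @ F).
  by apply: l1sum_cauchy_proj => // x y; rewrite -[leRHS]/(`|_| + `|_|) lerDr.
apply/cvg_ex; exists ((a1, a2) : l1sum X1 X2).
apply/(@cvgrPdist_lt _ _ _ F _ id) => e e0.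
have e20 : 0 < e / 2 by rewrite divr_gt0.
near=> x; rewrite -[ltLHS]/(`|a1 - x.1| + `|a2 - x.2|) (splitr e) ltrD//.
  by near: x; exact: Fa1.
by near: x; exact: Fa2.
Unshelve. all: by end_near. Qed.

HB.instance Definition _ :=
  Uniform_isComplete.Build (l1sum X1 X2) l1sum_complete.

End L1SumComplete.

(* Main.v *)
(* If [T] is EP with Moore-Penrose inverse [S], then [P = T S = S T] is an
   idempotent commuting with [T], so [X] splits as [ker (1 - P)] plus [ker P];
   [T] vanishes on the second summand and is invertible on the first, with
   inverse [S]. Conversely [S = J (T1^-1 (+) 0) J^-1] satisfies
   [T S = S T = J (I (+) 0) J^-1], which is hermitian by hypothesis. That this
   [S] is bounded is the bounded inverse theorem, a case of the open mapping
   theorem. *)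
Require Import Defs.
From HB Require Import structures.
From mathcomp Require Import all_boot all_order all_algebra.
From mathcomp Require Import complex.
From mathcomp Require Import all_classical all_reals.
From mathcomp Require Import topology normedtype sequences.
From mathcomp Require Import lra ring.
Import Order.TTheory GRing.Theory Num.Theory.
Import numFieldNormedType.Exports.
Local Open Scope classical_set_scope.
Local Open Scope ring_scope.

Set Implicit Arguments.
Unset Strict Implicit.
Unset Printing Implicit Defensive.

Local Open Scope complex_scope.

(** * Real-valued norms and limits of Cauchy sequences *)

Section RealNorm.
Context (R : realType) (X : normedModType R[i]).
Implicit Types x y : X.

Definition rnorm x : R := complex.Re `|x|.

Lemma rnormE x : `|x| = (rnorm x)%:C.
Proof. exact: normE_Re. Qed.

Lemma rnorm_ge0 x : 0 <= rnorm x.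
Proof. exact: Re_norm_ge0. Qed.

Lemma rnorm0 : rnorm 0 = 0.
Proof. by rewrite /rnorm normr0. Qed.

Lemma rnormD x y : rnorm (x + y) <= rnorm x + rnorm y.
Proof. by rewrite -lecR rmorphD/= -!rnormE ler_normD. Qed.

Lemma rnormN x : rnorm (- x) = rnorm x.
Proof. by rewrite /rnorm normrN. Qed.

Lemma rnormB x y : rnorm (x - y) = rnorm (y - x).
Proof. by rewrite -opprB rnormN. Qed.

Lemma rnormZ (a : R) x : 0 <= a -> rnorm (a%:C *: x) = a * rnorm x.
Proof.
move=> a0; apply: (@complexI R).
by rewrite rmorphM/= -!rnormE normrZ ger0_norm// lecR.
Qed.

Lemma rnorm_eq0 x : (rnorm x == 0) = (x == 0).
Proof. by rewrite -[RHS]normr_eq0 rnormE (inj_eq (@complexI R) _ 0). Qed.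

Lemma rnorm_small0 x : (forall e : R, 0 < e -> rnorm x <= e) -> x = 0.
Proof.
move=> x0; apply/eqP; rewrite -rnorm_eq0 eq_le rnorm_ge0 andbT.
by apply/ler_addgt0Pr => e /x0; rewrite add0r.
Qed.

End RealNorm.

Lemma bop_rnorm (R : realType) (X Y : normedModType R[i]) (A : bop X Y) :
  exists2 M : R, 0 < M & forall x, rnorm (A x) <= M * rnorm x.
Proof.
exists (opnorm A + 1) => [|x]; first by rewrite ltr_wpDl ?opnorm_ge0.
have : rnorm (A x) <= opnorm A * rnorm x.
  by rewrite -lecR rmorphM/= -!rnormE; exact: le_opnorm.
by move/le_trans; apply; rewrite mulrDl lerDl mul1r rnorm_ge0.
Qed.

(** As [e] takes arbitrarily small values, [u] is Cauchy; letting [m] tend to infinity carries the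
    bound [e n] over to the limit. *)
Lemma rnorm_cauchy_lim (R : realType) (X : completeNormedModType R[i])
    (u : nat -> X) (e : nat -> R) :
  (forall d, 0 < d -> exists n, e n < d) ->
  (forall n m, (n <= m)%N -> rnorm (u m - u n) <= e n) ->
  exists l, forall n, rnorm (l - u n) <= e n.
Proof.
move=> e0 ue.
have /cvg_ex[l ul] : cvg (u @ \oo).
  apply: cauchy_cvg; apply: cauchy_exP => d d0.
  (* Radii of balls lie in [R[i]], where being positive forces the imaginary part to vanish. *)
  have dE : d = (complex.Re d)%:C.
    by move: d0; case: (d) => a b; rewrite ltcE/= => /andP[/eqP-> _].
  rewrite dE ltcR in d0; have [n end_] := e0 _ d0.
  exists (u n); exists n => // m /= nm.
  rewrite -ball_normE/= dE rnormE ltcR rnormB.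
  exact: le_lt_trans (ue _ _ nm) end_.
exists l => n; apply/ler_addgt0Pr => d d0.
have dC : 0 < d%:C :> R[i] by rewrite ltcR.
have /cvgrPdist_lt/(_ _ dC)[m _ mP] := ul.
have := mP (maxn n m) (leq_maxr _ _); rewrite rnormE ltcR => lum.
rewrite -(subrKA (u (maxn n m))) (le_trans (rnormD _ _))// addrC lerD//.
  exact/ue/leq_maxl.
exact: ltW.
Qed.

Lemma half_pow_small (R : realType) (C d : R) :
  0 < d -> exists n, C / 2 ^+ n < d.
Proof.
move=> d0; exists (Num.truncn (`|C| / d)).+1.
rewrite ltr_pdivrMr ?exprn_gt0// mulrC -ltr_pdivrMr//.
rewrite (le_lt_trans _ (_ : `|C| / d < _))//.
  by rewrite ler_pM2r ?invr_gt0 ?ler_norm.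
rewrite (lt_le_trans (truncnS_gt _))// -natrX ler_nat ltnW//.
exact: ltn_expl.
Qed.

(** * The open mapping theorem and bounded inverses *)

Section OpenMapping.
Context (R : realType) (X Y : completeNormedModType R[i]) (A : bop X Y).
Hypothesis Asurj : forall y, exists x, A x = y.

(* Baire's argument: if no image of a ball were dense in a ball, nested closed
   balls avoiding the images of the balls of radius [n] would shrink to a point
   outside the range of [A]. *)
Lemma image_ball_somewhere_dense : exists (n : nat) (y : Y) (r : R), 0 < r /\
  forall y' r', 0 < r' -> r' <= r / 2 -> rnorm (y' - y) + r' <= r ->
    exists2 x, rnorm x <= n%:R & rnorm (A x - y') <= r'.
Proof.
apply: contrapT => nodense.
(* Positivity of the radius sits under the existential, so that [choice] yields a total function. *)
have step (nb : nat * (Y * R)) : exists b : Y * R, 0 < nb.2.2 ->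
    [/\ 0 < b.2, b.2 <= nb.2.2 / 2, rnorm (b.1 - nb.2.1) + b.2 <= nb.2.2
      & forall x, rnorm x <= nb.1%:R -> b.2 < rnorm (A x - b.1)].
  case: nb => n [y r] /=; have [r0|r0] := ltP 0 r; last first.
    by exists (y, r); rewrite /= ltNge r0.
  apply: contrapT => nob; apply: nodense; exists n, y, r; split => // y' r' *.
  apply: contrapT => nox; apply: nob; exists (y', r') => _; split => // x xn.
  by rewrite ltNge; apply/negP => xr; apply: nox; exists x.
have [f fP] := choice step.
pose fix b n := if n is m.+1 then f (m, b m) else (0 : Y, 1 : R).
have b0 n : 0 < (b n).2.
  by elim: n => [//|n /(fP (n, b n))[]].
have bS n := fP (n, b n) (b0 n).
have bnest n m : (n <= m)%N -> rnorm ((b m).1 - (b n).1) + (b m).2 <= (b n).2.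
  elim: m => [|m IH]; first by rewrite leqn0 => /eqP->;
    rewrite subrr rnorm0 add0r.
  rewrite leq_eqVlt ltnS => /predU1P[->|/IH nm].
    by rewrite subrr rnorm0 add0r.
  have [_ _ mS _] := bS m.
  have := rnormD ((b m.+1).1 - (b m).1) ((b m).1 - (b n).1).
  rewrite subrKA => D; move: nm mS D => /=; lra.
have bpow n : (b n).2 <= 1 / 2 ^+ n.
  elim: n => [|n IH]; first by rewrite expr0 divr1.
  have [_ h _ _] := bS n; apply: (le_trans h).
  by rewrite exprSr invfM mulrA ler_pM2r ?invr_gt0.
have [l lP] : exists l, forall n, rnorm (l - (b n).1) <= (b n).2.
  apply: (@rnorm_cauchy_lim _ _ (fun n => (b n).1)) => [d d0|n m /bnest].
    by have [n nd] := half_pow_small 1 d0; exists n; exact: le_lt_trans nd.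
  by move: (b0 m); lra.
have [x xl] := Asurj l.
(* The ball [b n.+1] avoids [A x] as soon as [rnorm x <= n], yet [l = A x] lies in every ball. *)
pose n := (Num.truncn (rnorm x)).+1.
have [_ _ _ /(_ x (ltW (truncnS_gt _)))] := bS n.
by rewrite xl ltNge (lP n.+1).
Qed.

(** A small [w] is the difference of [y0 + w] and [y0], both in the ball where images are dense, so
    subtracting their approximate preimages lifts [w]. Homogeneity extends this to all [y]. *)
Lemma approximate_lift : exists2 C : R, 0 < C &
  forall y, exists2 x, rnorm x <= C * rnorm y & rnorm (y - A x) <= rnorm y / 2.
Proof.
have [n [y0 [r [r0 dense]]]] := image_ball_somewhere_dense.
(* Two errors of [r / 8] add up to [r / 4], half the norm of [w]. *)
have lift w : rnorm w = r / 2 ->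
    exists2 x, rnorm x <= 2 * n%:R & rnorm (w - A x) <= r / 4.
  move=> wr.
  have [||| x1 x1n Ax1] := dense (y0 + w) (r / 8); [lra|lra| |].
    by rewrite addrAC subrr add0r wr; lra.
  have [||| x2 x2n Ax2] := dense y0 (r / 8); [lra|lra| |].
    by rewrite subrr rnorm0; lra.
  exists (x1 - x2); first by have := rnormD x1 (- x2); rewrite rnormN; lra.
  have -> : w - A (x1 - x2) = (y0 + w - A x1) - (y0 - A x2).
    by rewrite linearB/= !opprB [RHS]addrC !addrA subrK [w + _]addrC.
  rewrite (le_trans (rnormD _ _))// rnormN [rnorm (y0 + _ - _)]rnormB.
  by rewrite [rnorm (y0 - _)]rnormB; lra.
(* Rescaling [y] to norm [r / 2] divides the lift, of norm at most [2 * n], by [r / (2 * rnorm y)];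
   [n + 1] keeps the constant positive when [n = 0]. *)
exists (4 * (n%:R + 1) / r) => [|y].
  by rewrite divr_gt0// mulr_gt0// ltr_wpDl.
have [->|y0'] := eqVneq y 0.
  by exists 0; rewrite ?linear0 ?addr0 !rnorm0 ?mulr0 ?mul0r.
have Ny : 0 < rnorm y by rewrite lt_def rnorm_eq0 y0' rnorm_ge0.
pose a := r / (2 * rnorm y).
have a0 : 0 < a by rewrite divr_gt0// mulr_gt0.
have aN : a * rnorm y = r / 2 by rewrite /a; field; rewrite gt_eqF.
have [|x xn Ax] := lift (a%:C *: y); first by rewrite rnormZ// ltW.
exists (a^-1%:C *: x).
  rewrite rnormZ ?invr_ge0 ?(ltW a0)// ler_pdivrMl//.
  rewrite mulrCA aN (_ : _ * (r / 2) = 2 * n%:R + 2); last first.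
    by field; rewrite gt_eqF.
  by lra.
rewrite -(ler_pM2l a0) mulrA aN -rnormZ ?(ltW a0)//.
rewrite [A _]linearZ/= scalerBr scalerA.
by rewrite -rmorphM/= divff ?gt_eqF// scale1r (le_trans Ax)//; lra.
Qed.

(* Iterating the approximate lift on the residuals sums to an exact lift. *)
Theorem open_mapping : exists2 C : R, 0 < C &
  forall y, exists2 x, A x = y & rnorm x <= C * rnorm y.
Proof.
have [C C0 lift] := approximate_lift.
have {}lift y : exists x,
    rnorm x <= C * rnorm y /\ rnorm (y - A x) <= rnorm y / 2.
  by have [x ? ?] := lift y; exists x.
have [g gP] := choice lift.
exists (2 * C) => [|y]; first by rewrite mulr_gt0.
pose res n := iter n (fun z => z - A (g z)) y.
pose s n := \sum_(k < n) g (res k).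
have resN n : rnorm (res n) <= rnorm y / 2 ^+ n.
  elim: n => [|n IH]; first by rewrite expr0 divr1.
  have [_ /le_trans] := gP (res n); apply.
  by rewrite exprSr invfM mulrA ler_pM2r ?invr_gt0.
have As n : A (s n) = y - res n.
  elim: n => [|n IH]; first by rewrite /s big_ord0 linear0 subrr.
  rewrite /s big_ord_recr linearD/= -/(s n) IH opprB [RHS]addrCA.
  by rewrite addrC.
(* The bound is the exact geometric sum of [C * rnorm y / 2 ^+ k] for [n <= k < m], a form stable
   under induction on [m]. *)
have sN n m : (n <= m)%N ->
    rnorm (s m - s n) <= 2 * C * rnorm y / 2 ^+ n - 2 * C * rnorm y / 2 ^+ m.
  elim: m => [|m IH]; first by rewrite leqn0 => /eqP->; rewrite !subrr rnorm0.
  rewrite leq_eqVlt ltnS => /predU1P[->|/IH nm]; first by rewrite !subrr rnorm0.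
  rewrite /s big_ord_recr/= -/(s m) addrAC (le_trans (rnormD _ _))//.
  have [gm _] := gP (res m).
  have : C * rnorm (res m) <= C * (rnorm y / 2 ^+ m) by rewrite ler_pM2l.
  rewrite exprSr invfM; move: nm gm; set q := (2 ^+ m)^-1.
  lra.
have [x xP] : exists x, forall n, rnorm (x - s n) <= 2 * C * rnorm y / 2 ^+ n.
  apply: rnorm_cauchy_lim => [d d0|n m /sN]; first exact: half_pow_small.
  move/le_trans; apply; rewrite gerBl divr_ge0 ?exprn_ge0//.
  by rewrite !mulr_ge0 ?rnorm_ge0// ltW.
exists x; last by have := xP 0%N; rewrite /s big_ord0 subr0 expr0 divr1.
apply/subr0_eq/rnorm_small0 => e e0.
have [M M0 AM] := bop_rnorm A.
(* The two terms bound [A (x - s n)] and [res n], up to the factor [2 ^- n]. *)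
have [n ne] := half_pow_small (M * (2 * C * rnorm y) + rnorm y) e0.
rewrite (le_trans _ (ltW ne))// mulrDl -mulrA.
have -> : A x - y = A (x - s n) - res n.
  by rewrite [A (_ - _)]linearB/= As opprB addrA addrAC addrK.
rewrite (le_trans (rnormD _ _))// rnormN lerD//.
by rewrite (le_trans (AM _))// ler_pM2l.
Qed.

End OpenMapping.

(** By injectivity, the controlled preimage of [y] given by [open_mapping] can only be [B y]. *)
Lemma bounded_inverse (R : realType) (X Y : completeNormedModType R[i])
    (A : bop X Y) (B : Y -> X) :
  cancel A B -> cancel B A -> bounded_linear B.
Proof.
move=> AK BK; split=> [a x y|].
  by apply: (can_inj AK); rewrite linearP/= !BK.
have [|C _ CP] := @open_mapping _ _ _ A.
  by move=> y; exists (B y); exact: BK.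
exists C => y; have [x <- xC] := CP y.
by rewrite AK !rnormE -rmorphM lecR.
Qed.

(** * Kernels of bounded operators as Banach spaces *)

Section Kernel.
Context (R : realType) (X Y : normedModType R[i]) (f : bop X Y).

Definition bker_pred : {pred X} := [pred x | f x == 0].

Lemma bker_submod : submod_closed bker_pred.
Proof.
split=> [|a x y]; rewrite !inE ?linear0// => /eqP fx /eqP fy.
by rewrite linearP/= fx fy scaler0 addr0.
Qed.

HB.instance Definition _ := GRing.isSubmodClosed.Build R[i] X bker_pred
  (GRing.submod_closed_semi bker_submod).

Record bker := Bker { bker_val : X; _ : bker_val \in bker_pred }.

HB.instance Definition _ := [isSub for bker_val].
HB.instance Definition _ := [Choice of bker by <:].
HB.instance Definition _ := [SubChoice_isSubLmodule of bker by <:].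

Lemma bkerP (x : bker) : f (bker_val x) = 0.
Proof. by case: x => x /= /eqP. Qed.

Definition mkbker x (fx : f x = 0) : bker := Bker (introT eqP fx).

Let norm (x : bker) : R[i] := `|bker_val x|.

Let normD x y : norm (x + y) <= norm x + norm y.
Proof. exact: ler_normD. Qed.

Let normZ a x : norm (a *: x) = `|a| * norm x.
Proof. exact: normrZ. Qed.

Let norm_eq0 x : norm x = 0 -> x = 0.
Proof. by move/normr0_eq0 => x0; exact: val_inj. Qed.

HB.instance Definition _ :=
  Lmodule_isNormed.Build R[i] bker normD normZ norm_eq0.

End Kernel.

Section KernelComplete.
Context (R : realType) (X : completeNormedModType R[i]).
Context (Y : normedModType R[i]) (f : bop X Y).

(** The inclusion into [X] is isometric, so [F] has a limit in [X], and continuity of [f] puts this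
    limit in the kernel. *)
Lemma bker_complete (F : set_system (bker f)) :
  ProperFilter F -> cauchy F -> cvg F.
Proof.
move=> FF Fc.
have /cvg_ex[a /cvgrPdist_lt Fa] : cvg ((@bker_val _ _ _ f : bker f -> X) @ F).
  have /cauchyP Fc' := Fc; apply: cauchy_cvg; apply: cauchy_exP => e e0.
  have [x Fx] := Fc' e e0; exists (bker_val x).
  change (F ((@bker_val _ _ _ f : bker f -> X) @^-1` ball (bker_val x : X) e)).
  by apply: filterS Fx => y; rewrite /preimage/= -!ball_normE.
have fa : f a = 0.
  apply: rnorm_small0 => e e0; have [M M0 fM] := bop_rnorm f.
  have eM : 0 < (e / M)%:C :> R[i] by rewrite ltcR divr_gt0.
  have [x ax] := filter_ex (Fa _ eM).
  rewrite -[f a]subr0 -(bkerP x) -linearB (le_trans (fM _))//.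
  by rewrite mulrC -ler_pdivlMr// -lecR -rnormE ltW.
apply/cvg_ex; exists (mkbker fa).
by apply/(@cvgrPdist_lt _ _ _ F _ id) => e /Fa.
Qed.

HB.instance Definition _ := Uniform_isComplete.Build (bker f) bker_complete.

End KernelComplete.

Local Close Scope complex_scope.


Theorem theorem5p3 (R : realType) (X : completeNormedModType R[i])
    (T : bop X X) :
  EP T <->
  exists (X1 X2 : completeNormedModType R[i]) (T1 : bop X1 X1)
         (J : bop (l1sum X1 X2) X) (Jinv : X -> l1sum X1 X2),
    [/\ bijective T1,
        cancel J Jinv /\ cancel Jinv J,
        T =1 J \o oplus0 X2 T1 \o Jinv
      & exists P : bop X X,
          [/\ P =1 J \o oplus0 X2 (1 : bop X1 X1) \o Jinv,
              hermitian_op P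
            & P * P = P] ].
Proof.
split=> [[S [[TST STS hTS hST] TSC]]|].
  (* The existential makes [P] opaque, so that simplification does not unfold it into a product. *)
  have [P PD] : exists P, P = T * S by exists (T * S).
  have PP : P * P = P by rewrite PD mulrA -TST.
  have PT : P * T = T by rewrite PD -TST.
  have TP : T * P = T by rewrite PD TSC mulrA -TST.
  have PS : P * S = S by rewrite PD TSC -STS.
  have ST : S * T = P by rewrite PD TSC.
  have app (f g : bop X X) x : f = g -> f x = g x by move->.
  have PE x : P (P x) = P x by exact: app x PP.
  have PTE x : P (T x) = T x by exact: app x PT.
  have PSE x : P (S x) = S x by exact: app x PS.
  have TPE x : T (P x) = T x by exact: app x TP.
  have STE x : S (T x) = P x by exact: app x ST.
  have TSE x : T (S x) = P x by exact: app x (esym PD).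
  (* The range of [P] is presented as a kernel, which provides its completeness. *)
  pose X1 : completeNormedModType R[i] := bker (1 - P).
  pose X2 : completeNormedModType R[i] := bker P.
  have X1E x : P x = x -> (1 - P) x = 0.
    by move=> Px; rewrite -[LHS]/(x - P x) Px subrr.
  have X1P (x : X1) : P (bker_val x) = bker_val x.
    by apply/esym/subr0_eq; exact: (bkerP x).
  have X2E x : P (x - P x) = 0 by rewrite [P (_ - _)]linearB/= PE subrr.
  (* [P * T = T] and [P * S = S] say that [T] and [S] take values in the range of [P]. *)
  pose T1f (x : X1) : X1 := mkbker (X1E _ (PTE (bker_val x))).
  pose S1f (x : X1) : X1 := mkbker (X1E _ (PSE (bker_val x))).
  have T1b : bounded_linear T1f.
    split=> [a x y|]; first by apply: val_inj; exact: linearP.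
    by exists (opnorm T) => x; exact: le_opnorm.
  have Jb : bounded_linear
      (fun x : l1sum X1 X2 => bker_val x.1 + bker_val x.2 : X).
    split=> [a x y|].
      by rewrite -[LHS]/(a *: _ + _ + (a *: _ + _)) addrACA scalerDr.
    by exists 1 => x; rewrite mul1r; exact: ler_normD.
  (* The splitting [x = P x + (x - P x)]. *)
  pose Jinv (x : X) : l1sum X1 X2 :=
    (mkbker (X1E _ (PE x)) : X1, mkbker (X2E x) : X2).
  exists X1, X2, (mkbop T1b), (mkbop Jb), Jinv; split.
  - exists S1f => x; apply: val_inj => /=.
      by rewrite STE X1P.
    by rewrite TSE X1P.
  - split=> [[x y]|x]; last by rewrite /= addrC subrK.
    congr pair; apply: val_inj; rewrite /= linearD/= X1P (bkerP y) addr0//.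
    by rewrite addrAC subrr add0r.
  - by move=> x; rewrite /= addr0 TPE.
  exists P; split=> [x||//]; last by rewrite PD.
  by rewrite /= addr0.
move=> [X1 [X2 [T1 [J [Jinv]]]]].
move=> [[T1inv T1K T1Kinv] [JK JinvK] TE [P [PE hP PP]]].
pose T1' := mkbop (bounded_inverse T1K T1Kinv).
pose J' := mkbop (bounded_inverse JK JinvK).
pose S : bop X X := mkbop (bounded_linear_comp J
  (mkbop (bounded_linear_comp (oplus0 X2 T1') J'))).
have TS : T * S = P.
  by apply: bopP => x; rewrite PE -[LHS]/(T (S x)) TE /= JK /= T1Kinv.
have ST : S * T = P.
  by apply: bopP => x; rewrite PE -[LHS]/(S (T x)) TE /= JK /= T1K.
exists S; split; last by rewrite TS ST.
(* Both hermitian conditions become the one on [P]; what remains is [T = P * T] and [S = P * S],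
   true because [T] and [S] take values in the image of the first summand under [J]. *)
split; rewrite ?TS ?ST //.
  by apply: bopP => x; rewrite -[RHS]/(P (T x)) PE TE /= JK.
by apply: bopP => x; rewrite -[RHS]/(P (S x)) PE /= JK.
Qed.
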